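(* If $G$ is a block graph with $n(G)\ge 3$ vertices, then $\dim_{n\ell}(G)=\dim(\widehat{G})$, where $\widehat{G}$ is the block-cutpoint tree of $G$.
   Context: Graphs are finite, simple and connected; $d_G(u,v)$ is the shortest-path distance and $n(G)$ the number of vertices. A set $X\subseteq V(G)$ resolves two vertices $u,v$ if some $x\in X$ satisfies $d_G(u,x)\neq d_G(v,x)$. $X$ is a resolving set if it resolves every pair of distinct vertices; the metric dimension $\dim(G)$ is the minimum size of a resolving set (in particular $\dim(K_1)=0$). $X$ is a nonlocal resolving set if it resolves every pair of distinct non-adjacent vertices; the nonlocal metric dimension $\dim_{n\ell}(G)$ is the minimum size of a nonlocal resolving set. A block of $G$ is a maximal connected subgraph without a cut-vertex; a block graph is a connected graph in which every block is a complete graph. The block-cutpoint tree $\widehat{G}$ is the tree whose vertex set consists of the blocks and the cut-vertices of $G$, where a block $B$ is adjacent to a cut-vertex $v$ iff $v\in V(B)$ (if $G$ has no cut-vertex, $\widehat G=K_1$). *)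

(* Defs.v *)
(* Simple graphs: T : finType, e : rel T (symmetric, irreflexive). *)
From mathcomp Require Import all_boot.
Set Implicit Arguments. Unset Strict Implicit. Unset Printing Implicit Defensive.

Section Graphs.
Variables (T : finType) (e : rel T).

Fixpoint ball (n : nat) (u : T) : {set T} :=
  if n is n'.+1 then ball n' u :|: [set y | [exists x in ball n' u, e x y]]
  else [set u].

(* shortest-path distance d_G(u,v): least n with v within n steps of u
   (in a connected graph this is < #|T|; #|T| if unreachable). *)
Definition dist (u v : T) : nat := find (fun n => v \in ball n u) (iota 0 #|T|).

Definition resolves (X : {set T}) (u v : T) : bool :=
  [exists x in X, dist u x != dist v x].

Definition resolving (X : {set T}) : bool :=
  [forall u, forall v, (u != v) ==> resolves X u v].

Definition nonlocal_resolving (X : {set T}) : bool :=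
  [forall u, forall v, ((u != v) && ~~ e u v) ==> resolves X u v].

Definition metric_dim : nat :=
  #|[arg min_(X < [set: T] | resolving X) #|X|]|.

Definition nonlocal_metric_dim : nat :=
  #|[arg min_(X < [set: T] | nonlocal_resolving X) #|X|]|.

Definition rel_in (S : {set T}) : rel T :=
  [rel x y | [&& e x y, x \in S & y \in S]].

Definition connected_in (S : {set T}) : bool :=
  (S != set0) && [forall x in S, forall y in S, connect (rel_in S) x y].

Definition connected_graph : bool := connected_in [set: T].

Definition cut_vertex_in (S : {set T}) (v : T) : bool :=
  (v \in S) &&
  [exists x in S :\ v, exists y in S :\ v, ~~ connect (rel_in (S :\ v)) x y].

Definition cut_vertex (v : T) : bool := cut_vertex_in [set: T] v.

Definition nonseparable (S : {set T}) : bool :=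
  connected_in S && [forall v, ~~ cut_vertex_in S v].

Definition is_block (S : {set T}) : bool :=
  nonseparable S && [forall S' : {set T}, (S \proper S') ==> ~~ nonseparable S'].

Definition is_clique (S : {set T}) : bool :=
  [forall x in S, forall y in S, (x != y) ==> e x y].

Definition block_graph : bool :=
  connected_graph && [forall S : {set T}, is_block S ==> is_clique S].

Definition bct_pred : pred ({set T} + T) :=
  fun a => match a with inl B => is_block B | inr v => cut_vertex v end.

Definition bct_vert := {a : ({set T} + T) | bct_pred a}.

Definition bct_adj (a b : {set T} + T) : bool :=
  match a, b with
  | inl B, inr v => v \in B
  | inr v, inl B => v \in B
  | _, _ => false
  end.

Definition bct_rel : rel bct_vert := fun a b => bct_adj (val a) (val b).

End Graphs.

(* Main.v *)
Require Import Defs.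
From mathcomp Require Import all_boot zify.
Set Implicit Arguments. Unset Strict Implicit. Unset Printing Implicit Defensive.

(** In a block graph every block is a maximal clique, and two neighbours of [a]
    joined by a path avoiding [a] are equal or adjacent. Hence each vertex has
    a unique nearest vertex, its gate, in every block, and distances between
    points with different gates add up. Writing [delta y u] for the distance
    from [u] to [y], where [y] is a cut vertex or a block, the distance in the
    block-cutpoint tree is [2 * delta] up to a constant depending on the types
    of the two ends. With the gates this shows that a set [Y] of tree vertices
    is resolving iff [delta] separates all pairs of distinct non-adjacent
    vertices of the graph. A nonlocal resolving set yields such a [Y] by
    sending a non-cut vertex to its block. Conversely a block [B] in [Y] is
    traded for one of its vertices: a non-cut one if [Y] is a singleton, and
    otherwise any vertex other than the gate towards another element [z] of [Y];
    together with [z] it resolves whatever [B] does. *)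

(** * Balls and the shortest-path distance *)

Section Metric.
Variables (T : finType) (e : rel T).
Hypothesis e_sym : symmetric e.

Lemma ballS n u v :
  (v \in ball e n.+1 u) = (v \in ball e n u) || [exists x in ball e n u, e x v].
Proof. by rewrite /= !inE. Qed.

Lemma ball_add m n u v :
  (v \in ball e (m + n) u) = [exists w in ball e m u, v \in ball e n w].
Proof.
elim: n v => [|n IH] v.
  rewrite addn0; apply/idP/exists_inP => [vu|[w wu]].
    by exists v; rewrite //= inE.
  by rewrite /= inE => /eqP->.
rewrite addnS ballS IH; apply/orP/exists_inP.
  case=> [/exists_inP[w wu vw]|/exists_inP[x]].
    by exists w; rewrite // ballS vw.
  rewrite IH => /exists_inP[w wu xw] xv; exists w => //.
  by rewrite ballS; apply/orP; right; apply/exists_inP; exists x.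
case=> w wu; rewrite ballS => /orP[vw|/exists_inP[x xw xv]].
  by left; apply/exists_inP; exists w.
right; apply/exists_inP; exists x => //.
by rewrite IH; apply/exists_inP; exists w.
Qed.

Lemma ball1 u v : (v \in ball e 1 u) = (v == u) || e u v.
Proof.
rewrite ballS /= inE; congr orb; apply/exists_inP/idP => [[x]|uv].
  by rewrite inE => /eqP->.
by exists u; rewrite ?inE.
Qed.

Lemma ball_sym n u v : (v \in ball e n u) = (u \in ball e n v).
Proof.
elim: n u v => [|n IH] u v; first by rewrite /= !inE eq_sym.
rewrite -[in LHS]addn1 ball_add -[n.+1]add1n ball_add.
apply/exists_inP/exists_inP=> -[w wu vw]; exists w.
- by move: vw; rewrite !ball1 eq_sym e_sym.
- by rewrite -IH.
- by rewrite IH.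
- by move: wu; rewrite !ball1 eq_sym e_sym.
Qed.

Lemma dist_sym u v : dist e u v = dist e v u.
Proof. by apply: eq_find => n; rewrite ball_sym. Qed.

Lemma ball_leq m n u : m <= n -> ball e m u \subset ball e n u.
Proof.
move=> /subnKC <-; elim: (n - m) => [|k IH]; first by rewrite addn0.
by apply: subset_trans IH _; rewrite addnS subsetUl.
Qed.

Lemma dist_leq n u v : v \in ball e n u -> dist e u v <= n.
Proof.
move=> vu; case: (ltnP n #|T|) => [nT|nT]; last first.
  by apply: leq_trans nT; rewrite -[leqRHS](size_iota 0) find_size.
rewrite leqNgt; apply/negP => /(before_find 0).
by rewrite nth_iota // vu.
Qed.

Lemma dist_refl u : dist e u u = 0.
Proof. by apply/eqP; rewrite -leqn0 dist_leq //= inE. Qed.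

Lemma card_gt0_inhabited (u : T) : 0 < #|T|.
Proof. by apply/card_gt0P; exists u. Qed.

Lemma dist_gt0 u v : u != v -> 0 < dist e u v.
Proof.
move=> uv; rewrite lt0n; apply/eqP => d0.
have h : has (fun n => v \in ball e n u) (iota 0 #|T|).
  by rewrite has_find size_iota [find _ _]d0 (card_gt0_inhabited u).
move: (nth_find 0 h); rewrite [find _ _]d0 nth_iota ?(card_gt0_inhabited u) //= inE.
by rewrite eq_sym (negbTE uv).
Qed.

(* A potential with these three properties takes every value below [f y], so it
   never reaches the junk value [#|T|] of [dist]. *)
Lemma dist_potential (u : T) (f : T -> nat) :
    (forall y, (f y == 0) = (y == u)) ->
    (forall x y, e x y -> f y <= (f x).+1) ->
    (forall y n, f y = n.+1 -> exists2 x, e x y & f x = n) ->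
  forall y, dist e u y = f y.
Proof.
move=> f0 flip fdesc y.
have fball n v : (v \in ball e n u) = (f v <= n).
  elim: n v => [|n IH] v; first by rewrite /= inE leqn0 f0.
  rewrite ballS IH; apply/orP/idP => [[|/exists_inP[x]]|].
  - exact: leqW.
  - by rewrite IH => fx /flip /leq_trans; apply.
  rewrite leq_eqVlt => /orP[/eqP|]; last by left.
  move=> /fdesc[x xv fx]; right; apply/exists_inP; exists x => //.
  by rewrite IH fx.
have surj k : k <= f y -> exists x, f x == k.
  move=> /subKn <-; elim: (f y - k) => [|i [x /eqP fx]].
    by exists y; rewrite subn0.
  case: (posnP (f y - i)) => [i0|ipos].
    by exists x; rewrite fx; lia.
  have [|x' _ fx'] := fdesc x (f y - i).-1; first lia.
  by exists x'; rewrite fx'; lia.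
have fT : f y < #|T|.
  have ex (k : 'I_(f y).+1) : exists x, f x == k by apply: surj; rewrite -ltnS.
  pose g k := xchoose (ex k).
  have ginj : injective g.
    move=> j k jk; apply/val_inj/eqP.
    by rewrite /= -(eqP (xchooseP (ex j))) -(eqP (xchooseP (ex k))) -/(g j) jk.
  by rewrite -[(f y).+1]card_ord; apply: leq_card ginj.
apply/eqP; rewrite eqn_leq dist_leq ?fball //=.
rewrite leqNgt; apply/negP => lt.
have h : has (fun n => y \in ball e n u) (iota 0 #|T|).
  by rewrite has_find size_iota; apply: ltn_trans lt fT.
move: (nth_find 0 h); rewrite nth_iota; last by apply: ltn_trans lt fT.
by rewrite fball leqNgt add0n -/(dist e u y) lt.
Qed.

Lemma resolving_setT : resolving e [set: T].
Proof.
apply/forallP => u; apply/forallP => v; apply/implyP => uv.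
apply/exists_inP; exists u => //.
by rewrite dist_refl eq_sym -lt0n dist_gt0 // eq_sym.
Qed.

Lemma resolving_nonlocal X : resolving e X -> nonlocal_resolving e X.
Proof.
move=> /forallP rX; apply/forallP => u; apply/forallP => v.
by apply/implyP => /andP[uv _]; move/forallP: (rX u) => /(_ v); rewrite uv.
Qed.

Hypothesis e_conn : forall u v, connect e u v.

(** The search in [dist] succeeds: by connectivity there is a path without repetition, and it has
    fewer than [#|T|] edges. *)
Lemma leq_dist n u v : (dist e u v <= n) = (v \in ball e n u).
Proof.
apply/idP/idP; last exact: dist_leq.
have h : has (fun n => v \in ball e n u) (iota 0 #|T|).
  have /connectP[p0 pth ->] := e_conn u v.
  case/shortenP: pth => p pth uq _.
  have lastball : last u p \in ball e (size p) u.
    elim/last_ind: p pth {uq} => [|p x IH]; first by rewrite /= inE.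
    rewrite rcons_path last_rcons size_rcons ballS => /andP[pth xl].
    by apply/orP; right; apply/exists_inP; exists (last u p); rewrite ?IH.
  apply/hasP; exists (size p) => //.
  by rewrite mem_iota add0n /= -[(size p).+1]/(size (u :: p)) -(card_uniqP uq) max_card.
move: (nth_find 0 h); rewrite nth_iota; last by rewrite has_find size_iota in h.
by rewrite add0n => vu /ball_leq/subsetP; apply.
Qed.

Lemma dist_tri w u v : dist e u v <= dist e u w + dist e w v.
Proof.
by rewrite leq_dist ball_add; apply/exists_inP; exists w; rewrite -leq_dist.
Qed.

Lemma dist_eq0 u v : (dist e u v == 0) = (u == v).
Proof. by rewrite -leqn0 leq_dist /= inE eq_sym. Qed.

Lemma dist_le1 u v : (dist e u v <= 1) = (u == v) || e u v.
Proof. by rewrite leq_dist ball1 eq_sym. Qed.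

Lemma dist_edge u v x : e u v -> dist e u x <= (dist e v x).+1.
Proof.
by move=> uv; apply: leq_trans (dist_tri v _ _) _;
   rewrite -add1n leq_add2r dist_le1 uv orbT.
Qed.

Lemma dist_next u x : u != x -> exists2 v, e u v & dist e u x = (dist e v x).+1.
Proof.
move=> ux; have := dist_gt0 ux; case dE: (dist e u x) => [//|n] _.
have : dist e u x <= n.+1 by rewrite dE.
rewrite leq_dist -add1n ball_add => /exists_inP[v vu xv].
have dv : dist e v x <= n by rewrite leq_dist.
case/orP: (etrans (esym (ball1 _ _)) vu) => [/eqP vE|uv].
  by rewrite vE dE ltnn in dv.
by exists v => //; have := dist_edge x uv; lia.
Qed.

End Metric.

(** * Connectivity and nonseparability of induced subgraphs *)

Section InducedConnectivity.
Variables (T : finType) (e : rel T).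
Hypothesis e_sym : symmetric e.

Lemma rel_in_sym (S : {set T}) : symmetric (rel_in e S).
Proof. by move=> x y; rewrite /rel_in /= e_sym [(x \in S) && _]andbC. Qed.

Lemma connect_in_sym (S : {set T}) x y :
  connect (rel_in e S) x y = connect (rel_in e S) y x.
Proof. exact: sym_connect_sym (rel_in_sym S) x y. Qed.

Lemma connect_in_edge (S : {set T}) x y :
  x \in S -> y \in S -> e x y -> connect (rel_in e S) x y.
Proof. by move=> xS yS xy; apply: connect1; rewrite /rel_in /= xy xS. Qed.

Lemma connect_in_path (S : {set T}) x s :
  path e x s -> {subset x :: s <= S} -> {in x :: s, forall y, connect (rel_in e S) x y}.
Proof.
move=> pth sub; apply: path_connect.
elim: s x pth sub => [|y s IH] x //= /andP[xy pth] sub.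
rewrite {1}/rel_in /= xy !sub ?inE ?eqxx ?orbT //= IH // => z zs.
by rewrite sub // inE zs orbT.
Qed.

Lemma connected_inP (S : {set T}) r :
  r \in S -> {in S, forall x, connect (rel_in e S) x r} -> connected_in e S.
Proof.
move=> rS h; apply/andP; split; first by apply/set0Pn; exists r.
apply/forall_inP => x xS; apply/forall_inP => y yS.
by apply: connect_trans (h x xS) _; rewrite connect_in_sym h.
Qed.

Lemma not_cut_vertex_in (S : {set T}) v r :
  {in S :\ v, forall x, connect (rel_in e (S :\ v)) x r} -> ~~ cut_vertex_in e S v.
Proof.
move=> h; rewrite negb_and; apply/orP; right.
apply/exists_inP => -[x xS /exists_inP[y yS]].
by rewrite (connect_trans (h x xS)) // connect_in_sym h.
Qed.

Lemma clique_nonseparable (S : {set T}) r :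
  r \in S -> is_clique e S -> nonseparable e S.
Proof.
move=> rS /forall_inP cl.
have adj x y : x \in S -> y \in S -> x != y -> e x y.
  by move=> xS yS xy; have /forall_inP/(_ y yS) := cl x xS; rewrite xy.
apply/andP; split.
  apply: (connected_inP rS) => x xS; case: (eqVneq x r) => [->//|xr].
  by apply: connect_in_edge; rewrite ?adj.
apply/forallP => v; case: (pickP [pred x in S :\ v]) => [s /= sS|none].
  apply: (@not_cut_vertex_in S v s) => x xS; case: (eqVneq x s) => [->//|xs].
  apply: connect_in_edge => //; apply: adj => //.
    by move: xS; rewrite inE => /andP[].
  by move: sS; rewrite inE => /andP[].
by apply: (@not_cut_vertex_in S v r) => x xS; move: (none x); rewrite /= xS.
Qed.

(** Deleting [v] breaks a path without repetition into at most two pieces, each keeping an end of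
    the path. *)
Lemma connect_path_ends (S : {set T}) v p s w :
    path e p s -> uniq (p :: s) -> {subset p :: s <= S} ->
    w \in p :: s -> w != v ->
  (p != v /\ connect (rel_in e (S :\ v)) p w) \/
  (last p s != v /\ connect (rel_in e (S :\ v)) w (last p s)).
Proof.
elim: s p => [|q s IH] p.
  by move=> _ _ _; rewrite inE => /eqP-> pv; left.
case/andP => pq pth /andP[pn uq] sub.
rewrite inE; case: (eqVneq w p) => [->|wp] /= wqs wv; first by left.
have sub' : {subset q :: s <= S} by move=> z zs; rewrite sub // inE zs orbT.
case: (IH q pth uq sub' wqs wv) => [[qv qw]|]; last by right.
case: (eqVneq p v) => pv.
  right.
  have sub2 : {subset q :: s <= S :\ v}.
    by move=> z zs; rewrite !inE sub' // andbT; apply: contraNneq pn; rewrite -pv => <-.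
  have lv : last q s \in S :\ v by apply/sub2/mem_last.
  split; first by move: lv; rewrite !inE => /andP[].
  rewrite connect_in_sym in qw.
  by apply: connect_trans qw (connect_in_path pth sub2 _); rewrite mem_last.
left; split=> //; apply: connect_trans qw; apply: connect_in_edge => //.
  by rewrite !inE pv sub // inE eqxx.
by rewrite !inE qv sub' // inE eqxx.
Qed.

(** Without a vertex [v] other than [a], each remaining vertex still reaches an end of the path and
    hence [a]; without [a], the path itself remains. *)
Lemma cycle_nonseparable a p s :
    path e p s -> uniq (p :: s) -> a \notin p :: s -> e a p -> e a (last p s) ->
  nonseparable e (a |: [set x in p :: s]).
Proof.
move=> pth uq aps ap al; set S := _ |: _.
have aS : a \in S by rewrite !inE eqxx.
have sub : {subset p :: s <= S} by move=> z zs; rewrite !inE -in_cons zs orbT.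
have suba : {subset p :: s <= S :\ a}.
  by move=> z zs; rewrite inE sub // andbT inE; apply: contraNneq aps => <-.
have conn v : v != a -> {in S :\ v, forall x, connect (rel_in e (S :\ v)) x a}.
  move=> va x; rewrite in_setD1 in_setU1 => /andP[xv /orP[/eqP->//|]].
  rewrite inE => xs.
  have aSv : a \in S :\ v by rewrite !inE eq_sym va eqxx.
  case: (connect_path_ends pth uq sub xs xv) => -[nv c].
    rewrite connect_in_sym; apply: connect_trans c.
    by apply: connect_in_edge => //; rewrite inE sub ?mem_head // andbT inE.
  apply: connect_trans c _; rewrite connect_in_sym.
  by apply: connect_in_edge => //; rewrite inE sub ?mem_last // andbT inE.
apply/andP; split.
  have pS : p \in S by rewrite sub ?mem_head.
  apply: (connected_inP pS) => x; rewrite in_setU1 => /orP[/eqP->|].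
    exact: connect_in_edge.
  by rewrite connect_in_sym inE => xs; apply: connect_in_path xs.
apply/forallP => v; case: (eqVneq v a) => [->|/conn]; last exact: not_cut_vertex_in.
apply: (@not_cut_vertex_in S a p) => x; rewrite connect_in_sym in_setD1 in_setU1.
case/andP=> /negbTE-> /=; rewrite inE => xs.
exact: connect_in_path xs.
Qed.

Lemma block_exists (S : {set T}) :
  nonseparable e S -> exists2 B, is_block e B & S \subset B.
Proof.
move=> /maxset_exists[B /maxsetP[nB max] SB]; exists B => //.
rewrite /is_block nB; apply/forallP => B'; apply/implyP => BB'; apply/negP => nB'.
by move: (BB'); rewrite (max B' nB' (proper_sub BB')) properxx.
Qed.

End InducedConnectivity.

(** * Separation by a vertex in a block graph *)

Section BlockGraph.
Variables (T : finType) (e : rel T).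
Hypotheses (e_sym : symmetric e) (e_irr : irreflexive e) (e_bg : block_graph e).

Local Notation d := (dist e).
Local Notation conn_off a := (connect (rel_in e ([set: T] :\ a))).

Lemma block_graph_connect u v : connect e u v.
Proof.
case/andP: e_bg => /andP[_ /forall_inP h] _.
have /forall_inP := h u (in_setT u) => /(_ v (in_setT v)).
by apply: connect_sub => x y /and3P[xy _ _]; apply: connect1.
Qed.
Let e_conn := block_graph_connect.

Lemma conn_off_sym a p q : conn_off a p q = conn_off a q p.
Proof. exact: connect_in_sym. Qed.

Lemma conn_off_edge a p q : p != a -> q != a -> e p q -> conn_off a p q.
Proof. by move=> pa qa; apply: connect_in_edge; rewrite !inE ?pa ?qa. Qed.

Lemma edge_neq x y : e x y -> x != y.
Proof. by move=> xy; apply: contraTneq xy => ->; rewrite e_irr. Qed.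

Lemma block_clique B x y : is_block e B -> x \in B -> y \in B -> x != y -> e x y.
Proof.
move=> bB xB yB xy; case/andP: e_bg => _ /forallP/(_ B); rewrite bB /=.
by move=> /forall_inP/(_ x xB)/forall_inP/(_ y yB); rewrite xy.
Qed.

(* A path around [a] closes up to a cycle through [a], which lies in a single
   block, hence in a clique. *)
Lemma neighbours_conn_off a p q : e p a -> e a q -> conn_off a p q -> p = q \/ e p q.
Proof.
move=> pa aq /connectP[s0 pth0 qE]; move: qE aq.
case/shortenP: pth0 => s pth uq _ -> {s0 q} al.
have [/eqP sE|s_n0] := boolP (s == [::]); first by left; rewrite sE.
have pa' := edge_neq pa.
have pths : path e p s.
  by apply: sub_path pth => x y /and3P[].
have as_ : a \notin p :: s.
  rewrite inE negb_or eq_sym pa' /=; apply/negP => ain.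
  elim: s p pth {uq al s_n0 pa pa' pths} ain => [|y s IH] x //= /andP[/and3P[_ _ ya] pth].
  rewrite inE => /orP[/eqP aE|]; last exact: IH pth.
  by rewrite aE !inE eqxx in ya.
rewrite e_sym in pa.
have [B bB sub] := block_exists (cycle_nonseparable e_sym pths uq as_ pa al).
case: (eqVneq p (last p s)) => [|pl]; [by left|right].
apply: (block_clique bB) => //; apply: (subsetP sub).
  by rewrite !inE eqxx orbT.
by rewrite in_setU1 inE mem_last orbT.
Qed.

(** The walk [p], [b], [q] avoids [a]. *)
Lemma no_diamond a b p q :
  a != b -> e p a -> e a q -> e p b -> e b q -> p = q \/ e p q.
Proof.
move=> ab pa aq pb bq; apply: (neighbours_conn_off pa aq).
apply: (connect_trans (y := b)); apply: conn_off_edge => //.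
- exact: edge_neq.
- by rewrite eq_sym.
- by rewrite eq_sym.
- by rewrite eq_sym edge_neq.
Qed.

(** Distances to [x] decrease along a geodesic from [p], so after its start it only meets vertices
    nearer to [x] than [a]. *)
Lemma conn_off_dist a p x : p != a -> d p x <= d a x -> conn_off a p x.
Proof.
move: {2}(d p x) (leqnn (d p x)) => n.
elim: n p => [|n IH] p lt pa le.
  by move: lt; rewrite leqn0 dist_eq0 // => /eqP->.
case: (eqVneq p x) => [->//|/(dist_next e_conn)[p' pp' dE]].
have p'a : p' != a by apply: contraTneq le => <-; lia.
by apply: connect_trans (conn_off_edge pa p'a pp') (IH _ _ p'a _); lia.
Qed.

(** Every walk from [p] to [q] meets [a], so a geodesic does. *)
Lemma dist_not_conn_off a p q : ~~ conn_off a p q -> d p q = d p a + d a q.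
Proof.
move: {2}(d p q) (leqnn (d p q)) => n.
elim: n p => [|n IH] p.
  by rewrite leqn0 dist_eq0 // => /eqP->; rewrite connect0.
move=> lt nc; case: (eqVneq p a) => [->|pa]; first by rewrite dist_refl.
case: (eqVneq p q) => [pq|/(dist_next e_conn)[p' pp' dE]].
  by rewrite pq connect0 in nc.
case: (eqVneq p' a) => [p'a|p'a].
  have := dist_tri e_conn a p q; have := dist_edge e_conn a pp'.
  by rewrite dE p'a dist_refl; lia.
have := IH p'; have := dist_tri e_conn a p q; have := dist_edge e_conn a pp'.
suff: ~~ conn_off a p' q by lia.
by apply: contra nc => c; apply: connect_trans c; apply: conn_off_edge.
Qed.

(** * Blocks as maximal cliques, and cut vertices *)

Lemma block_nonempty B : is_block e B -> exists x, x \in B.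
Proof. by case/andP => /andP[/andP[/set0Pn]]. Qed.

(** Otherwise [x |: B] would be a larger clique, and cliques are nonseparable. *)
Lemma block_maximal B x :
  is_block e B -> (forall y, y \in B -> y != x -> e y x) -> x \in B.
Proof.
move=> bB adj; apply: contraT => xB.
have /andP[_ /forallP/(_ (x |: B))] := bB.
rewrite properE subsetUr subUset sub1set (negbTE xB) /= => /negP[].
apply: (@clique_nonseparable _ _ e_sym _ x); first by rewrite !inE eqxx.
apply/forall_inP => y; rewrite !inE => yB; apply/forall_inP => z; rewrite !inE => zB.
apply/implyP => yz; case/orP: yB zB => [/eqP yx|yB] /orP[/eqP zx|zB].
- by rewrite yx zx eqxx in yz.
- by rewrite yx e_sym adj //; apply: contraNneq xB => <-.
- by rewrite zx adj // -zx.
- exact: (block_clique bB).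
Qed.

Lemma block_of_edge x y : e x y -> exists B, [/\ is_block e B, x \in B & y \in B].
Proof.
move=> xy; have cl : is_clique e [set x; y].
  apply/forall_inP => u; rewrite !inE => /orP[]/eqP->;
  apply/forall_inP => v; rewrite !inE => /orP[]/eqP->;
  by rewrite ?eqxx ?xy ?(e_sym y x) ?xy ?implybT.
have [|B bB /subsetP sub] := block_exists (clique_nonseparable e_sym (r := x) _ cl).
  by rewrite !inE eqxx.
by exists B; split=> //; apply: sub; rewrite !inE eqxx ?orbT.
Qed.

Lemma block_of_vertex x : exists2 B, is_block e B & x \in B.
Proof.
have cl : is_clique e [set x].
  apply/forall_inP => u /set1P->; apply/forall_inP => v /set1P->.
  by rewrite eqxx.
have [|B bB /subsetP sub] := block_exists (clique_nonseparable e_sym (r := x) _ cl).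
  by rewrite inE.
by exists B => //; apply: sub; rewrite inE.
Qed.

(** [a] and [b] are common neighbours of [p] and of any further [y] in [B], so [no_diamond] makes
    [p] adjacent to [y], and maximality applies. *)
Lemma block_triangle B a b p :
  is_block e B -> a \in B -> b \in B -> a != b -> e p a -> e p b -> p \in B.
Proof.
move=> bB aB bB' ab pa pb; apply: (block_maximal bB) => y yB yp.
case: (eqVneq y a) => [->|ya]; first by rewrite e_sym.
case: (eqVneq y b) => [->|yb]; first by rewrite e_sym.
have [||||yE|//] := @no_diamond a b y p ab.
- exact: (block_clique bB).
- by rewrite e_sym.
- exact: (block_clique bB).
- by rewrite e_sym.
by rewrite yE eqxx in yp.
Qed.

Lemma block_inj A B a b :
  is_block e A -> is_block e B -> a != b ->
  a \in A -> b \in A -> a \in B -> b \in B -> A = B.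
Proof.
move=> bA bB ab aA bA' aB bB'; apply/eqP; rewrite eqEsubset; apply/andP.
have h C D : is_block e C -> is_block e D -> a \in C -> b \in C ->
    a \in D -> b \in D -> C \subset D.
  move=> bC bD aC bC' aD bD'; apply/subsetP => x xC.
  case: (eqVneq x a) => [->//|xa]; case: (eqVneq x b) => [->//|xb].
  by apply: (@block_triangle D a b x) => //; apply: (block_clique bC).
by split; apply: h.
Qed.

(** If [v] separates two vertices, take for [p] and [q] the first steps of geodesics from [v] to
    them. Conversely, a path from [p] to [q] off [v] would make them adjacent. *)
Lemma cut_vertexP v :
  reflect (exists p q, [/\ e v p, e v q, p != q & ~~ e p q]) (cut_vertex e v).
Proof.
apply: (iffP idP) => [|[p [q [vp vq pq npq]]]].
  case/andP=> _ /exists_inP[x xv /exists_inP[y yv nc]].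
  rewrite !inE !andbT in xv yv.
  have nxt z : z != v -> exists2 p, e v p & conn_off v p z.
    rewrite eq_sym => /(dist_next e_conn)[p vp dE]; exists p => //.
    by apply: conn_off_dist; [rewrite eq_sym edge_neq | lia].
  have [p vp px] := nxt x xv; have [q vq qy] := nxt y yv.
  have ncpq : ~~ conn_off v p q.
    apply: contra nc => pq; rewrite conn_off_sym in px.
    exact: connect_trans px (connect_trans pq qy).
  exists p, q; split=> //; first by apply: contraNneq ncpq => ->.
  apply: contra ncpq => pq; apply: conn_off_edge => //;
  by rewrite eq_sym edge_neq.
apply/andP; split; first by rewrite inE.
apply/exists_inP; exists p; first by rewrite !inE eq_sym edge_neq.
apply/exists_inP; exists q; first by rewrite !inE eq_sym edge_neq.
apply/negP => c; have [||pqE|pqE] := @neighbours_conn_off v p q _ _ c => //.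
- by rewrite e_sym.
- by rewrite pqE eqxx in pq.
- by rewrite pqE in npq.
Qed.

(** If [A] and [B] differ, some [p] in [A] lies outside [B], and maximality of [B] gives [q] in [B]
    not adjacent to [p]; two such neighbours make [v] a cut vertex. *)
Lemma noncut_block A B v :
  ~~ cut_vertex e v -> is_block e A -> is_block e B -> v \in A -> v \in B -> A = B.
Proof.
move=> nv bA bB vA vB; apply/eqP/contraT => AB; case/negP: nv.
have [p pA pB] : exists2 p, p \in A & p \notin B.
  apply/subsetPn; apply: contra AB => sAB; rewrite eqEsubset sAB /=.
  apply: contraT => nBA; move/andP: bA => [_ /forallP/(_ B)].
  by rewrite properE sAB nBA /=; case/andP: bB => ->.
have [q qB qp] : exists2 q, q \in B & ~~ ((q == p) || e q p).
  apply/exists_inP; apply: contraNT pB => /exists_inPn h.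
  apply: (block_maximal bB) => y yB /negbTE yp.
  by move: (h y yB); rewrite negbK yp.
have vp : e v p by apply: (block_clique bA) => //; apply: contraNneq pB => <-.
case/norP: qp => qp nqp.
have vq : e v q.
  by apply: (block_clique bB) => //; apply: contraNneq nqp => <-.
by apply/cut_vertexP; exists q, p.
Qed.

Lemma noncut_nbr B v w : ~~ cut_vertex e v -> is_block e B -> v \in B -> e v w -> w \in B.
Proof.
move=> nv bB vB vw; have [A [bA vA wA]] := block_of_edge vw.
by rewrite (noncut_block nv bB bA).
Qed.

Lemma cut_of_two_blocks A B v :
  is_block e A -> is_block e B -> A != B -> v \in A -> v \in B -> cut_vertex e v.
Proof.
move=> bA bB AB vA vB; apply: contraT => nv.
by rewrite (noncut_block nv bA bB) ?eqxx in AB.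
Qed.

(** * Distances to sets, and gates in blocks *)

Definition minover (A : {set T}) (F : T -> nat) : nat :=
  if [pick a in A] is Some a0 then F [arg min_(a < a0 in A) F a] else 0.

Lemma minover_ex (A : {set T}) F a0 :
  a0 \in A -> exists2 a, a \in A & minover A F = F a.
Proof.
rewrite /minover; case: pickP => [a1 a1A _|none aA]; last by move: (none a0); rewrite aA.
by case: arg_minnP => // a aA _; exists a.
Qed.

Lemma minover_le (A : {set T}) F a : a \in A -> minover A F <= F a.
Proof.
rewrite /minover; case: pickP => [a1 a1A aA|none aA]; last by move: (none a); rewrite aA.
by case: arg_minnP => // b _; apply.
Qed.

Implicit Types (S A B : {set T}) (u v w x z : T).

Definition dset (S : {set T}) (u : T) : nat := minover S (d u).

Lemma dset_le S u s : s \in S -> dset S u <= d u s.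
Proof. exact: minover_le. Qed.

Lemma dset_ex S u s0 : s0 \in S -> exists2 s, s \in S & dset S u = d u s.
Proof. exact: minover_ex. Qed.

Lemma dset_eq0 S u s0 : s0 \in S -> (dset S u == 0) = (u \in S).
Proof.
move=> s0S; apply/idP/idP => [|uS]; last first.
  by rewrite -leqn0 (leq_trans (dset_le _ uS)) ?dist_refl.
by have [s sS ->] := dset_ex u s0S; rewrite dist_eq0 // => /eqP->.
Qed.

Lemma dset_edge S u v s0 : s0 \in S -> e u v -> dset S u <= (dset S v).+1.
Proof.
move=> s0S uv; have [s sS ->] := dset_ex v s0S.
exact: leq_trans (dset_le u sS) (dist_edge e_conn s uv).
Qed.

Lemma dset_next S u s0 :
  s0 \in S -> u \notin S -> exists2 v, e u v & dset S u = (dset S v).+1.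
Proof.
move=> s0S uS; have [s sS dE] := dset_ex u s0S.
have us : u != s by apply: contraNneq uS => ->.
have [v uv dE'] := dist_next e_conn us; exists v => //.
by have := dset_le v sS; have := dset_edge s0S uv; lia.
Qed.

Let dsym := dist_sym e_sym.

Lemma dist_block B x y : is_block e B -> x \in B -> y \in B -> x != y -> d x y = 1.
Proof.
move=> bB xB yB xy; apply/eqP; rewrite eqn_leq dist_le1 //.
by rewrite (block_clique bB xB yB xy) orbT dist_gt0.
Qed.

Lemma dset_block B u b : is_block e B -> b \in B -> d u b <= (dset B u).+1.
Proof.
move=> bB bB'; have [s sB ->] := dset_ex u bB'.
case: (eqVneq s b) => [->//|sb].
by have := dist_tri e_conn s u b; rewrite (dist_block bB sB bB' sb); lia.
Qed.

(** If [g] is not [u], let [p] be the first step from [g] to [u]. Both [p] and [h] reach [u] without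
    passing [g], so they are equal or adjacent; then [p] belongs to the block, although it is nearer
    to [u] than [g]. *)
Lemma gate_unique B u g h :
  is_block e B -> g \in B -> h \in B -> d u g = dset B u -> d u h = dset B u -> g = h.
Proof.
move=> bB gB hB dg dh; apply/eqP/contraT => gh.
case: (eqVneq g u) => [gu|/(dist_next e_conn)[p gp dE]].
  by move: dg dh; rewrite gu dist_refl => <- /eqP; rewrite dist_eq0 // -gu (negbTE gh).
have dhu : d h u = d g u by rewrite -!(dsym u) dg dh.
have pB : p \notin B.
  by apply/negP => pB; have := dset_le u pB; rewrite -dg !(dsym u); lia.
have ph : p != h by apply: contraNneq pB => ->.
have c1 : conn_off g p u by apply: conn_off_dist; [rewrite eq_sym edge_neq | lia].
have c2 : conn_off g u h.
  by rewrite conn_off_sym; apply: conn_off_dist; [rewrite eq_sym | lia].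
have pg : e p g by rewrite e_sym.
have [pE|ph'] := neighbours_conn_off pg (block_clique bB gB hB gh) (connect_trans c1 c2).
  by rewrite pE eqxx in ph.
by rewrite (block_triangle bB gB hB) in pB.
Qed.

(* [w] is the gate of [u] in [B] but not that of [z], so it separates [u] from [z]. *)
Lemma dist_gates B w u z :
    is_block e B -> w \in B -> d u w = dset B u -> d z w != dset B z ->
  d u z = dset B u + (dset B z).+1.
Proof.
move=> bB wB duw dzw.
have dzw' : d z w = (dset B z).+1.
  by have := dset_le z wB; have := dset_block z bB wB; lia.
have [g gB dzg] := dset_ex z wB.
have gw : g != w by apply: contraNneq dzw => <-; rewrite dzg.
rewrite -duw -dzw' (dsym z); apply: dist_not_conn_off; apply/negP => c.
case: (eqVneq w u) => [wu|wu].
  have zw : z != w by apply/eqP => zE; rewrite zE dist_refl in dzw'.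
  rewrite -wu in c; case/connectP: c => -[|y s] /=.
    by move=> _ zE; rewrite zE eqxx in zw.
  by case/andP=> /and3P[_]; rewrite !inE eqxx.
have c1 : conn_off w z g.
  rewrite conn_off_sym; apply: conn_off_dist => //.
  by rewrite !(dsym _ z); lia.
(* The first step [p] from [w] to [u] and the gate [g] of [z] would be neighbours of [w] joined off
   [w]. Equal or adjacent, they make [g] as near to [u] as [w], against uniqueness of the gate. *)
have [p wp dE] := dist_next e_conn wu.
have c2 : conn_off w p u by apply: conn_off_dist; [rewrite eq_sym edge_neq | lia].
have pw : e p w by rewrite e_sym.
have wg : e w g by apply: (block_clique bB) => //; rewrite eq_sym.
have dug : d u w < d u g.
  rewrite ltn_neqAle duw dset_le // andbT; apply/negP => /eqP dg.
  by case/negP: gw; apply/eqP/(gate_unique bB gB wB _ duw).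
move: dug; rewrite !(dsym u) dE.
case: (neighbours_conn_off pw wg (connect_trans c2 (connect_trans c c1))) => [->|].
  by rewrite ltnNge leqnSn.
by rewrite e_sym => /(dist_edge e_conn u); rewrite leqNgt => /negP.
Qed.

(** The upper bound matching [dist_gates]: travel through the gate of [u]. *)
Lemma dset_tri B u z b :
  is_block e B -> b \in B -> d u z <= dset B u + (dset B z).+1.
Proof.
move=> bB bB'; have [g gB dg] := dset_ex u bB'.
apply: leq_trans (dist_tri e_conn g u z) _.
by rewrite -dg leq_add2l (dsym g) dset_block.
Qed.

(** * Further vertices and blocks around a vertex *)

Hypothesis T_gt1 : 1 < #|T|.

(** If [x] were alone in its block, a neighbour of [x], which exists in a connected graph with
    another vertex, could be added to the clique. *)
Lemma block_other B x : is_block e B -> x \in B -> exists2 z, z \in B & z != x.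
Proof.
move=> bB xB; apply/exists_inP; apply: contraT => /exists_inPn none.
have Bx y : y \in B -> y = x by move=> /none; rewrite negbK => /eqP.
have : 0 < #|predC1 x| by rewrite cardC1; case: #|T| T_gt1 => [|[]].
case/card_gt0P => z; rewrite !inE eq_sym => /(dist_next e_conn)[y xy _].
have /Bx yx : y \in B by apply: (block_maximal bB) => // t /Bx->.
by rewrite yx e_irr in xy.
Qed.

Lemma cut_other_block B v :
  is_block e B -> v \in B -> cut_vertex e v ->
  exists A, [/\ is_block e A, v \in A & A != B].
Proof.
move=> bB vB /cut_vertexP[p [q [vp vq pq npq]]].
have h x : e v x -> x \notin B -> exists A, [/\ is_block e A, v \in A & A != B].
  move=> vx xB; have [A [bA vA xA]] := block_of_edge vx.
  by exists A; split=> //; apply: contraNneq xB => <-.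
case: (boolP (p \in B)) => [pB|]; last exact: h.
case: (boolP (q \in B)) => [qB|]; last exact: h.
by rewrite (block_clique bB) in npq.
Qed.

(** A geodesic from [x] to [u] starts inside [B], where all neighbours of [x] lie; so [x] is not the
    gate of [u]. *)
Lemma noncut_dset B x u :
  is_block e B -> x \in B -> ~~ cut_vertex e x -> u != x -> d u x = (dset B u).+1.
Proof.
move=> bB xB nx; rewrite eq_sym => /(dist_next e_conn)[v xv].
have vB := noncut_nbr nx bB xB xv.
by rewrite !(dsym _ u) => dE; have := dset_le u vB; have := dset_block u bB xB; lia.
Qed.

(** * Distances in the block-cutpoint tree *)

Implicit Types (y : {set T} + T) (a b : bct_vert e) (Y : {set bct_vert e}).

Definition carrier y : {set T} := match y with inl B => B | inr v => [set v] end.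

Definition block_flag y : nat := if y is inl _ then 1 else 0.

Local Notation delta y := (dset (carrier y)).

Lemma carrier_nonempty y : bct_pred e y -> exists s, s \in carrier y.
Proof.
case: y => [B bB|v _]; first exact: block_nonempty.
by exists v; rewrite inE.
Qed.

(** Closed form of the tree distance from [y] to [t]: an edge of the graph costs two tree edges,
    through its block, and an end that is a block costs one more. For [A = y] this count would give
    2, hence the separate case. *)
Definition bdist y (t : {set T} + T) : nat :=
  match t with
  | inr v => (delta y v).*2 + block_flag y
  | inl A => if inl A == y then 0 else (minover A (delta y)).*2.+1 + block_flag y
  end.

Lemma delta_block y A v :
  bct_pred e y -> is_block e A -> v \in A -> delta y v <= (minover A (delta y)).+1.
Proof.
move=> /carrier_nonempty[s sy] bA vA; have [w wA ->] := minover_ex (delta y) vA.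
case: (eqVneq v w) => [->//|vw].
by apply: (dset_edge sy); apply: (block_clique bA).
Qed.

Lemma bct_rel_sym : symmetric (@bct_rel T e).
Proof. by move=> [[A|v] ?] [[B|w] ?]. Qed.

(** [dist_potential] applies to [bdist y]. To descend, a block moves to its vertex nearest to [y]; a
    cut vertex moves to [y] if that is a block containing it, and otherwise to the block of the
    first edge towards [y]. *)
Lemma dist_bct a b : dist (@bct_rel T e) a b = bdist (val a) (val b).
Proof.
move: b; have := valP a; move aE : (val a) => y py.
have [s sy] := carrier_nonempty py.
apply: (dist_potential (f := fun b => bdist y (val b))).
- move=> b; rewrite -val_eqE aE; case: (val b) => [A|v]; rewrite /bdist.
    by case: (inl A == y); rewrite ?addSn.
  rewrite addn_eq0 double_eq0 (dset_eq0 _ sy).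
  by case: (y) => [B|w]; rewrite ?andbF //= inE andbT.
- move=> b c; rewrite /bct_rel; have := valP b; have := valP c.
  case: (val b) => [A|v]; case: (val c) => [B|w] /= pc pb; [by [] | | | by []].
    move=> wA; case: eqP => [yE|_].
      have /eqP-> : delta y w == 0 by rewrite (dset_eq0 _ sy) -yE.
      by rewrite -yE.
    by move: (delta_block py pb wA); clear; lia.
  move=> vB; case: ifP => // _.
  by move: (minover_le (delta y) vB); clear; lia.
move=> b n; have := valP b; case bE: (val b) => [A|v] /= pb.
  case: eqP => // Ay fE.
  have [v vA dE] : exists2 v, v \in A & minover A (delta y) = delta y v.
    by have [t tA] := block_nonempty pb; apply: minover_ex tA.
  (* This vertex is [y], or it lies in a second block: [y], or the block of the next edge towards
     [y], which leaves [A]. *)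
  have cv : cut_vertex e v.
    case: (boolP (v \in carrier y)) => [|/(dset_next sy)[w vw wE]].
      case: (y) py Ay => [B|w] /= py' Ay; last by rewrite inE => /eqP->.
      move=> vB; apply: (cut_of_two_blocks pb py') => //.
      by apply/eqP => AB; rewrite AB in Ay.
    have wA : w \notin A.
      by apply/negP => /(minover_le (delta y)); rewrite dE wE ltnn.
    have [B [bB vB wB]] := block_of_edge vw.
    by apply: (cut_of_two_blocks pb bB) => //; apply: contraNneq wA => ->.
  exists (exist _ (inr v) cv : bct_vert e); first by rewrite /bct_rel bE.
  by move: fE => /=; rewrite -dE; clear; lia.
case: (boolP (v \in carrier y)) => [vy|vy] fE.
  exists a.
    rewrite /bct_rel bE aE; move: vy fE; case: (y) => [B|w] //= vw.
    by rewrite addn0 (eqP (_ : dset [set w] v == 0)) // (dset_eq0 _ vw).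
  move: fE; rewrite (eqP (_ : delta y v == 0)) ?(dset_eq0 _ sy) // aE.
  by case: (y) => [B|w] //= []; rewrite eqxx.
have [w vw wE] := dset_next sy vy.
have [B [bB vB wB]] := block_of_edge vw.
exists (exist _ (inl B) bB : bct_vert e); first by rewrite /bct_rel bE.
have Bn : (inl B == y) = false by apply/eqP => yE; rewrite -yE vB in vy.
rewrite /= Bn.
by move: (delta_block py bB vB) (minover_le (delta y) wB) wE fE; clear; lia.
Qed.

Lemma resolving_bctP Y :
  reflect (forall a b, a != b ->
             exists2 y, y \in Y & bdist (val y) (val a) != bdist (val y) (val b))
          (resolving (@bct_rel T e) Y).
Proof.
apply: (iffP forallP) => [h a b ab|h a].
  have /forallP/(_ b) := h a; rewrite ab => /exists_inP[y yY].
  by rewrite ![dist _ _ y](dist_sym bct_rel_sym) !dist_bct; exists y.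
apply/forallP => b; apply/implyP => /h[y yY ne]; apply/exists_inP; exists y => //.
by rewrite ![dist _ _ y](dist_sym bct_rel_sym) !dist_bct.
Qed.

(** Two vertices of one block with different gates in [B] can be at distance 1 only if both lie in
    [B], and two common vertices make the blocks equal. *)
Lemma gate_carrier y B w z z' :
    bct_pred e y -> is_block e B -> inl B != y -> z \in carrier y -> z' \in carrier y ->
    w \in B -> d z w = dset B z ->
  d z' w = dset B z'.
Proof.
case: y => [A|v] /= py bB By; last by rewrite !inE => /eqP-> /eqP->.
move=> zA z'A wB dz; apply/eqP/contraT => dz'.
have zz' : z != z' by apply: contraNneq dz' => <-; rewrite dz.
have := dist_gates bB wB dz dz'; rewrite (dist_block py zA z'A zz') => dE.
have zB : z \in B by rewrite -(dset_eq0 _ wB); lia.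
have z'B : z' \in B by rewrite -(dset_eq0 _ wB); lia.
by case/negP: By; rewrite (block_inj bB py zz').
Qed.

Lemma delta_noncut y B u :
    bct_pred e y -> is_block e B -> inl B != y -> u \in B -> ~~ cut_vertex e u ->
  delta y u = (minover B (delta y)).+1.
Proof.
move=> py bB By uB nu; have [s sy] := carrier_nonempty py.
have uy : u \notin carrier y.
  case: y py By {sy} => [A|v] /= py By; last by rewrite inE; apply: contraNneq nu => ->.
  by apply: contra By => uA; rewrite (noncut_block nu bB py).
have [v uv dE] := dset_next sy uy.
have vB := noncut_nbr nu bB uB uv.
by have := minover_le (delta y) vB; have := delta_block py bB uB; lia.
Qed.

(** * Resolving sets of the tree and separation by [delta] *)

Definition delta_resolving Y :=
  forall u v, u != v -> ~~ e u v ->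
    exists2 y, y \in Y & delta (val y) u != delta (val y) v.

Lemma delta_carrier y u v :
  u \in carrier y -> v \notin carrier y -> delta y u != delta y v.
Proof.
move=> uy vy; rewrite (eqP (_ : delta y u == 0)) ?(dset_eq0 _ uy) //.
by rewrite eq_sym (dset_eq0 _ uy).
Qed.

(** Take the block [A] of [u], the block [B] by which a geodesic leaves [v] towards [u], and a [y]
    separating them in the tree. If [delta] agreed on [u] and [v], then either the minima over [A]
    and [B] would agree, or [v] would be the gate of [y] but not of [u] in [B], which makes [u]
    strictly farther than [v]. *)
Lemma resolving_mixed Y u v :
    resolving (@bct_rel T e) Y -> ~~ cut_vertex e u -> cut_vertex e v ->
    u != v -> ~~ e u v ->
  exists2 y, y \in Y & delta (val y) u != delta (val y) v.
Proof.
move=> /resolving_bctP rY nu cv uv nuv.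
have [A bA uA] := block_of_vertex u.
have vA : v \notin A by apply: contra nuv => vA; apply: (block_clique bA).
have [v' vv' dE] : exists2 v', e v v' & d v u = (d v' u).+1.
  by apply: (dist_next e_conn); rewrite eq_sym.
have [B [bB vB v'B]] := block_of_edge vv'.
have AB : A != B by apply: contraNneq vA => ->.
have uB : u \notin B.
  by apply: contra AB => uB; rewrite (noncut_block nu bA bB).
have [|y yY yE] := rY (exist _ (inl A) bA : bct_vert e) (exist _ (inl B) bB : bct_vert e).
  by rewrite -val_eqE /=; apply: contra AB => /eqP[->].
exists y => //; move: yE; have := valP y.
move: (val y) => {yY} y py; rewrite /bdist /=.
have [s0 s0y] := carrier_nonempty py.
case: (eqVneq (inl A) y) => [yE _|Ay].
  by apply: delta_carrier => //; rewrite -yE.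
case: (eqVneq (inl B) y) => [yE _|By].
  by rewrite eq_sym; apply: delta_carrier => //; rewrite -yE.
apply: contra => /eqP duv.
have := delta_noncut py bA Ay uA nu.
have := delta_block py bB vB; have := minover_le (delta y) vB.
rewrite -duv leq_eqVlt => /orP[/eqP mE _ _|lt le mE]; last first.
  by have -> : minover A (delta y) = minover B (delta y) by move: lt le mE; clear; lia.
have [s sy ds] := dset_ex v s0y; have [s' s'y ds'] := dset_ex u s0y.
have gs : d s v = dset B s.
  have := dset_le s vB; rewrite leq_eqVlt => /orP[/eqP//|].
  have [g gB ->] := dset_ex s vB; have := minover_le (delta y) gB.
  have := dset_le g sy.
  by rewrite mE duv ds !(dsym s); clear; lia.
have gs' := gate_carrier py bB By sy s'y vB gs.
have nuv' : d u v != dset B u.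
  have := dset_le u v'B; rewrite !(dsym u) dE => le.
  by apply/eqP => E; move: le; rewrite -E ltnn.
have := dist_gates bB vB gs' nuv'; rewrite (dsym s') -ds' duv -gs' (dsym s') => E.
by have := dset_le v s'y; rewrite E; clear; lia.
Qed.

(** Two cut vertices are themselves in the tree. For two non-cut vertices separate their blocks and
    use [delta_noncut]. *)
Lemma resolving_delta Y : resolving (@bct_rel T e) Y -> delta_resolving Y.
Proof.
move=> rY u v uv nuv; have /resolving_bctP h := rY.
case: (boolP (cut_vertex e u)) => cu; case: (boolP (cut_vertex e v)) => cv.
- have [|y yY ne] := h (exist _ (inr u) cu : bct_vert e)
                       (exist _ (inr v) cv : bct_vert e).
    by rewrite -val_eqE.
  by exists y => //; apply: contraNneq ne => /= ->.
- have [||y yY ne] := @resolving_mixed Y v u rY cv cu.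
  + by rewrite eq_sym.
  + by rewrite e_sym.
  by exists y; rewrite // eq_sym.
- exact: resolving_mixed.
have [A bA uA] := block_of_vertex u; have [B bB vB] := block_of_vertex v.
have vA : v \notin A by apply: contra nuv => vA; apply: (block_clique bA).
have uB : u \notin B by apply: contra nuv => uB; apply: (block_clique bB).
have [|y yY] := h (exist _ (inl A) bA : bct_vert e) (exist _ (inl B) bB : bct_vert e).
  by rewrite -val_eqE /=; apply: contraNneq vA => -[->].
move=> yE; exists y => //; move: yE; have := valP y.
move: (val y) => {yY} y py; rewrite /bdist /=.
case: (eqVneq (inl A) y) => [yE _|Ay].
  by apply: delta_carrier => //; rewrite -yE.
case: (eqVneq (inl B) y) => [yE _|By].
  by rewrite eq_sym; apply: delta_carrier => //; rewrite -yE.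
rewrite (delta_noncut py bA Ay uA cu) (delta_noncut py bB By vB cv).
by apply: contra => /eqP[->].
Qed.

(** If the gate of [y] in [A] were not [a], the way from [b] to [y] would run through [a], making
    [b] farther than [a]. So [a] is the gate. *)
Lemma delta_step y A B (a b a' : T) :
    bct_pred e y -> is_block e A -> is_block e B -> A != B -> a \in A -> a \in B ->
    b \in B -> b != a -> a' \in A -> a' != a -> delta y b <= delta y a ->
  delta y a' = (delta y a).+1.
Proof.
move=> py bA bB AB aA aB bB' ba a'A a'a le.
have [s0 s0y] := carrier_nonempty py.
have bA' : b \notin A.
  by apply: contra AB => bA'; rewrite (block_inj bA bB ba).
have dba : d b a = dset A b.
  have := dset_le b aA; rewrite (dist_block bB bB' aB ba).
  by have := dset_eq0 b aA; rewrite (negbTE bA'); case: (dset A b) => [|[]].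
have Ay : inl A != y.
  apply: contraNneq bA' => yE.
  by rewrite -[A]/(carrier (inl A)) yE -(dset_eq0 _ s0y) -leqn0 (leq_trans le) //
     leqn0 (dset_eq0 _ s0y) -yE.
have [s' s'y ds'] := dset_ex b s0y.
have gs' : d s' a = dset A s'.
  apply/eqP/contraT => ne; have := dist_gates bA aA dba ne.
  have := dset_le a s'y; have := dset_block s' bA aA.
  by rewrite -ds' -dba (dist_block bB bB' aB ba) !(dsym s'); move: le; clear; lia.
have [s sy ds] := dset_ex a' s0y.
have gs := gate_carrier py bA Ay s'y sy aA gs'.
have a's : d s a' != dset A s.
  by apply: contra a'a => /eqP E; rewrite (gate_unique bA a'A aA E gs).
have := dset_le s a'A; have := dset_le a sy.
have : delta y a' <= (delta y a).+1.
  by apply: (dset_edge s0y); apply: (block_clique bA).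
by move: a's; rewrite ds -gs !(dsym s); clear; lia.
Qed.

(** If [a] attained the minimum over [A], it would be the gate of [y]. The gate of [B] is [c], so
    the way from [y] to [B] would cross [A], and [B] would be strictly farther than [A]. *)
Lemma delta_far y A B (a c : T) :
    bct_pred e y -> is_block e A -> is_block e B -> inl A != y -> c \in A ->
    (forall x, x \in B -> d x c = dset A x) ->
    a \in A -> a != c -> minover B (delta y) <= minover A (delta y) ->
  delta y a = (minover A (delta y)).+1.
Proof.
move=> py bA bB Ay cA gB aA ac le.
have [s0 s0y] := carrier_nonempty py.
have := delta_block py bA aA; rewrite leq_eqVlt => /orP[/eqP//|]; rewrite ltnS => le'.
have [b0 b0B] := block_nonempty bB.
have [b bB' dB] := minover_ex (delta y) b0B.
have [s2 s2y ds2] := dset_ex b s0y; have [s sy ds] := dset_ex a s0y.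
have gs : d s a = dset A s.
  apply/eqP; rewrite eq_sym eqn_leq dset_le //=.
  have [g gA ->] := dset_ex s aA; have := minover_le (delta y) gA.
  have := dset_le g sy.
  by rewrite !(dsym s) -ds; move: le'; clear; lia.
have gs2 := gate_carrier py bA Ay sy s2y aA gs.
have ba : d b a != dset A b.
  by apply: contra ac => /eqP E; rewrite (gate_unique bA aA cA E (gB b bB')).
have := dist_gates bA aA gs2 ba; have := dset_le a s2y.
rewrite -gs2 !(dsym s2) -ds2 -dB => h1 h2.
by have := minover_le (delta y) aA; move: h1 h2 le; clear; lia.
Qed.

Lemma gate_between A B :
    is_block e A -> is_block e B -> A != B ->
  exists2 c, c \in A & forall x, x \in B -> d x c = dset A x.
Proof.
move=> bA bB AB; have [b0 b0B] := block_nonempty bB.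
have [a0 a0A] := block_nonempty bA.
have [c cA dc] := dset_ex b0 a0A; exists c => // b bB'.
by apply: (@gate_carrier (inl B) A c b0 b).
Qed.

(** Test [Y] on a vertex [a] of [A] that is not the gate of [B] and a vertex [b] of [B] that is not
    the gate of [A]. They are not adjacent, and if the minima over [A] and [B] agree, [delta_far]
    puts both one above them. *)
Lemma delta_resolving_blocks Y A B :
    delta_resolving Y -> is_block e A -> is_block e B -> A != B ->
  exists2 y, y \in Y & bdist (val y) (inl A) != bdist (val y) (inl B).
Proof.
move=> rY bA bB AB; have BA : B != A by rewrite eq_sym.
have [c cA gB] := gate_between bA bB AB; have [c' c'B gA] := gate_between bB bA BA.
have [a aA ac] := block_other bA cA; have [b bB' bc'] := block_other bB c'B.
have dba : 1 < d b a.
  have ne : d b a != dset A b.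
    by apply: contra ac => /eqP E; rewrite (gate_unique bA aA cA E (gB b bB')).
  have bc : b != c.
    apply: contra bc' => /eqP bc; have := gA c cA; rewrite -bc.
    rewrite (eqP (_ : dset B b == 0)) ?(dset_eq0 _ bB') // => /eqP.
    by rewrite dist_eq0.
  have := dset_le b aA; have := gB b bB'; have := dist_gt0 e bc.
  by move: ne; clear; lia.
have [||y yY ne] := rY b a.
- by apply: contraTneq dba => ->; rewrite dist_refl.
- by apply: contraTN dba => ba; rewrite -leqNgt dist_le1 // ba orbT.
exists y => //; apply: contra ne; have := valP y.
move: (val y) => {yY} y py; rewrite /bdist /=.
case: (eqVneq (inl A) y) => Ay; case: (eqVneq (inl B) y) => By // /eqP E.
- by case: (etrans Ay (esym By)) AB => ->; rewrite eqxx.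
- have mE : minover A (delta y) = minover B (delta y) by move: E; clear; lia.
rewrite (delta_far py bA bB Ay cA gB aA ac) ?mE //.
by rewrite (delta_far py bB bA By c'B gA bB' bc') ?mE.
Qed.

(** Prolong the edge at both ends out of its block, to [a'] and [b'] at distance 3. If [y] is
    equally far from [a] and [b], [delta_step] makes it equally far from [a'] and [b']. *)
Lemma delta_resolving_adjacent Y (a b : T) :
    delta_resolving Y -> cut_vertex e a -> cut_vertex e b -> e a b ->
  exists2 y, y \in Y & delta (val y) a != delta (val y) b.
Proof.
move=> rY ca cb ab; have [B [bB aB bB']] := block_of_edge ab.
have nab := edge_neq ab; have nba : b != a by rewrite eq_sym.
have [A [bA aA AB]] := cut_other_block bB aB ca.
have [C [bC bC' CB]] := cut_other_block bB bB' cb.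
have [a' a'A a'a] := block_other bA aA; have [b' b'C b'b] := block_other bC bC'.
have out D x x' : is_block e D -> D != B -> x \in D -> x \in B -> x' \in D -> x' != x ->
    d x' x = dset B x' /\ dset B x' = 1.
  move=> bD DB xD xB x'D x'x.
  have x'B : x' \notin B by apply: contra DB => x'B; rewrite (block_inj bD bB x'x).
  have := dset_le x' xB; have := dset_eq0 x' xB.
  rewrite (dist_block bD x'D xD x'x) (negbTE x'B).
  by case: (dset B x') => [|[]].
have [ga a1] := out _ _ _ bA AB aA aB a'A a'a.
have [gb b1] := out _ _ _ bC CB bC' bB' b'C b'b.
have d3 : d a' b' = 3.
  have ne : d b' a != dset B b'.
    by apply: contra nab => /eqP E; rewrite (gate_unique bB aB bB' E gb).
  by rewrite (dist_gates bB aB ga ne) a1 b1.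
have [||y yY ne] := rY a' b'.
- by apply: contraTneq isT => E; rewrite E dist_refl in d3.
- by apply/negP => E; have := dist_le1 e_conn a' b'; rewrite d3 E orbT.
exists y => //; apply: contra ne => /eqP E.
rewrite (delta_step (valP y) bA bB AB aA aB bB' nba a'A a'a) ?E //.
by rewrite (delta_step (valP y) bC bB CB bC' bB' aB nab b'C b'b) ?E.
Qed.

Lemma delta_resolving_resolving Y : delta_resolving Y -> resolving (@bct_rel T e) Y.
Proof.
move=> rY; apply/resolving_bctP => a b; rewrite -val_eqE.
(* Tree distances from [y] to a block and to a cut vertex differ in parity. *)
have mixed A v y : bdist y (inl A) != bdist y (inr v).
  rewrite /bdist; case: (eqVneq (inl A) y) => [<-|_]; first by rewrite addn1.
  by clear; lia.
(* A cut vertex has two non-adjacent neighbours, which some element of [Y] has to separate. *)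
have Y0 v : cut_vertex e v -> exists a, a \in Y.
  by case/cut_vertexP => p [q [_ _ pq npq]]; have [y yY _] := rY p q pq npq; exists y.
have := valP a; have := valP b.
case: (val a) => [A|u]; case: (val b) => [B|v] pb pa ab.
- by apply: delta_resolving_blocks => //; apply: contra ab => /eqP->.
- by have [y yY] := Y0 v pb; exists y.
- by have [y yY] := Y0 u pa; exists y; rewrite // eq_sym.
have uv : u != v by apply: contra ab => /eqP->.
have [y yY ne] : exists2 y, y \in Y & delta (val y) u != delta (val y) v.
  case: (boolP (e u v)) => [|nuv]; last exact: rY.
  exact: delta_resolving_adjacent.
by exists y => //; rewrite eqn_add2r (inj_eq double_inj).
Qed.

(** * Exchange between resolving sets of the tree and of the graph *)

Lemma noncut_resolves B x u v :
    is_block e B -> x \in B -> ~~ cut_vertex e x -> u != v -> ~~ e u v ->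
  (d u x != d v x) = (dset B u != dset B v).
Proof.
move=> bB xB nx.
(* Away from [x] the two quantities differ by the constant 1. At [x] itself both comparisons
   succeed, since a vertex not adjacent to [x] lies outside [B]. *)
have hx w w' : w = x -> w != w' -> ~~ e w w' ->
    (d w x != d w' x) && (dset B w != dset B w').
  move=> -> xw' nxw'; apply/andP; split.
    by rewrite dist_refl eq_sym -lt0n dist_gt0 // eq_sym.
  apply: (@delta_carrier (inl B)) => //=.
  by apply: contra nxw' => w'B; apply: (block_clique bB).
move=> uv nuv; case: (eqVneq u x) => [ux|ux].
  by have /andP[-> ->] := hx u v ux uv nuv.
case: (eqVneq v x) => [vx|vx].
  have := hx v u vx; rewrite eq_sym e_sym => /(_ uv nuv)/andP[].
  by rewrite ![_ == _ u _]eq_sym ![_ == dset B u]eq_sym => -> ->.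
by rewrite !(noncut_dset bB xB nx).
Qed.

Lemma nonlocal_to_bct (X : {set T}) :
    nonlocal_resolving e X ->
  exists2 Y : {set bct_vert e}, resolving (@bct_rel T e) Y & #|Y| <= #|X|.
Proof.
move=> /forallP rX.
have /fin_all_exists[hat hatP] x : exists y : bct_vert e, forall u v,
    u != v -> ~~ e u v -> d u x != d v x -> delta (val y) u != delta (val y) v.
  case: (boolP (cut_vertex e x)) => cx.
    exists (exist _ (inr x) cx : bct_vert e) => u v _ _ /=.
    have dset1 w : dset [set x] w = d w x.
      by have [s /set1P-> ->] := dset_ex w (set11 x).
    by rewrite !dset1.
  have [B bB xB] := block_of_vertex x.
  exists (exist _ (inl B) bB : bct_vert e) => u v uv nuv.
  by rewrite (noncut_resolves bB xB cx).
exists (hat @: X); last exact: leq_imset_card.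
apply: delta_resolving_resolving => u v uv nuv.
have /forallP/(_ v) := rX u; rewrite uv nuv => /exists_inP[x xX ne].
by exists (hat x); [apply: imset_f | apply: hatP].
Qed.

Lemma bct_to_nonlocal_small Y :
    resolving (@bct_rel T e) Y -> #|Y| <= 1 ->
  exists2 X : {set T}, nonlocal_resolving e X & #|X| <= #|Y|.
Proof.
move=> rY Y1; have dY := resolving_delta rY.
have [Y0|/set0Pn[y yY]] := eqVneq Y set0.
  exists set0; last by rewrite cards0.
  apply/forallP => u; apply/forallP => v; apply/implyP => /andP[uv nuv].
  by have [y] := dY u v uv nuv; rewrite Y0 inE.
have Yy (z : bct_vert e) : z \in Y -> z = y.
  by move=> zY; move/card_le1P: Y1 => /(_ y yY z); rewrite zY inE => /esym/eqP.
suff [x xP] : exists x, forall u v, u != v -> ~~ e u v ->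
    delta (val y) u != delta (val y) v -> d u x != d v x.
  exists [set x]; last by rewrite cards1 (cardD1 y) yY.
  apply/forallP => u; apply/forallP => v; apply/implyP => /andP[uv nuv].
  have [z /Yy-> ne] := dY u v uv nuv.
  by apply/exists_inP; exists x; rewrite ?inE // xP.
have := valP y; case yE: (val y) => [B|v] /= py; last first.
  exists v => u w _ _; have [s /set1P-> ->] := dset_ex u (set11 v).
  by have [s' /set1P-> ->] := dset_ex w (set11 v).
(* If all vertices of [B] were cut vertices, two of them would both be tree neighbours of [B], the
   only element of [Y], and stay unresolved. *)
have [x xB nx] : exists2 x, x \in B & ~~ cut_vertex e x.
  apply/exists_inP; apply: contraT => /exists_inPn h.
  have allcut x : x \in B -> cut_vertex e x by move=> /h; rewrite negbK.
  have [x xB] := block_nonempty py; have [x' x'B xx'] := block_other py xB.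
  have /resolving_bctP rY' := rY.
  have [|z /Yy->] := rY' (exist _ (inr x') (allcut _ x'B) : bct_vert e)
                         (exist _ (inr x) (allcut _ xB) : bct_vert e).
    by rewrite -val_eqE.
  rewrite yE /= (eqP (_ : dset B x' == 0)) ?(dset_eq0 _ xB) //.
  by rewrite (eqP (_ : dset B x == 0)) ?(dset_eq0 _ xB).
by exists x => u v uv nuv; rewrite (noncut_resolves py xB nx).
Qed.

Lemma bct_to_nonlocal_large Y :
    resolving (@bct_rel T e) Y -> 1 < #|Y| ->
  exists2 X : {set T}, nonlocal_resolving e X & #|X| <= #|Y|.
Proof.
move=> rY Y1; have dY := resolving_delta rY.
(* [phi z] is not known when [phi y] is chosen, so the condition ranges over the whole carrier of
   [z]; its vertices share one gate in [B]. *)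
have /fin_all_exists[phi phiP] (y : bct_vert e) : exists w, w \in carrier (val y) /\
    forall B, val y = inl B ->
      exists2 z, z \in Y & forall z', z' \in carrier (val z) -> d z' w != dset B z'.
  have := valP y; case yE: (val y) => [B|v] /= py; last by exists v; rewrite inE.
  have [z zY zy] : exists2 z, z \in Y & z != y.
    have [z1 [z2 [z1Y z2Y z12]]] := card_gt1P Y1.
    case: (eqVneq z1 y) => [z1y|]; last by exists z1.
    by exists z2; rewrite // -z1y eq_sym.
  have Bz : inl B != val z by rewrite -yE val_eqE eq_sym.
  have [t tz] := carrier_nonempty (valP z); have [b bB] := block_nonempty py.
  have [g gB dg] := dset_ex t bB; have [w wB wg] := block_other py gB.
  exists w; split=> // _ [<-]; exists z => // z' z'z.
  apply: contra wg => /eqP dw.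
  by rewrite (gate_unique py wB gB (gate_carrier (valP z) py Bz z'z tz wB dw)).
exists (phi @: Y); last exact: leq_imset_card.
apply/forallP => u; apply/forallP => v; apply/implyP => /andP[uv nuv].
have [y yY ne] := dY u v uv nuv; have [wy zP] := phiP y.
have := valP y; case yE: (val y) ne wy zP => [B|x] /= ne wy zP py; last first.
  apply/exists_inP; exists (phi y); first exact: imset_f.
  move/set1P: wy => ->; move: ne; have [s /set1P-> ->] := dset_ex u (set11 x).
  by have [s' /set1P-> ->] := dset_ex v (set11 x).
have [z zY zg] := zP B erefl; have dz := zg _ (phiP z).1.
apply/exists_inP; have [ew|] := eqVneq (d u (phi y)) (d v (phi y)); last first.
  by exists (phi y); rewrite ?imset_f.
exists (phi z); first exact: imset_f.
(* A vertex [t] is one farther from [phi y] than from [B] unless [phi y] is its gate; then the bound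
   on its distance to [phi z] is attained. Of two vertices equally far from [phi y] but not from
   [B], just one has the gate [phi y], and it is farther from [phi z]. *)
have bound t : [/\ d t (phi y) <= (dset B t).+1,
    d t (phi z) <= dset B t + (dset B (phi z)).+1 &
    (dset B t).+1 <= d t (phi y) \/ d t (phi z) = dset B t + (dset B (phi z)).+1].
  split; [exact: dset_block | exact: dset_tri wy |].
  have := dset_le t wy; rewrite leq_eqVlt => /orP[/eqP dt|]; last by left.
  by right; apply: dist_gates dz.
have [u1 u2 u3] := bound u; have [v1 v2 v3] := bound v.
by move: u1 u2 u3 v1 v2 v3 ew ne; clear; lia.
Qed.

Lemma bct_to_nonlocal Y :
    resolving (@bct_rel T e) Y ->
  exists2 X : {set T}, nonlocal_resolving e X & #|X| <= #|Y|.
Proof.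
move=> rY; case: (leqP #|Y| 1) => [|]; first exact: bct_to_nonlocal_small.
exact: bct_to_nonlocal_large.
Qed.

End BlockGraph.

(** * Comparison of the minimum sizes *)

Theorem theorem3p1 (T : finType) (e : rel T) :
  symmetric e -> irreflexive e -> block_graph e -> 3 <= #|T| ->
  nonlocal_metric_dim e = metric_dim (@bct_rel T e).
Proof.
move=> e_sym e_irr e_bg T3; have T2 := ltnW T3.
rewrite /nonlocal_metric_dim /metric_dim.
case: arg_minnP => [|X rX minX]; first exact/resolving_nonlocal/resolving_setT.
case: arg_minnP => [|Y rY minY]; first exact: resolving_setT.
apply/eqP; rewrite eqn_leq; apply/andP; split.
  have [X' rX' le] := bct_to_nonlocal e_sym e_irr e_bg T2 rY.
  exact: leq_trans (minX X' rX') le.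
have [Y' rY' le] := nonlocal_to_bct e_sym e_irr e_bg T2 rX.
exact: leq_trans (minY Y' rY') le.
Qed.
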